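(* Let $(F,\xi,\eta,g)$ be an almost contact metric structure on a $(2n+1)$-dimensional manifold which is $\alpha$-Sasakian or $\alpha$-Kenmotsu with $\alpha$ constant. Then the corresponding pair $(P(U(n)\times1),g)$ is a quasi homogeneous structure, i.e. $\overline\nabla h=0$.
   Context: An almost contact metric structure on $M$, $\dim M=2n+1$, consists of a Riemannian metric $g=\langle\,,\rangle$, a unit vector field $\xi$, the 1-form $\eta(X)=\langle X,\xi\rangle$, and a $(1,1)$ tensor field $F$ with $F\xi=0$, preserving $V=\xi^\perp$, with $F^2=-I$ on $V$ and $\langle FX,FY\rangle=\langle X,Y\rangle$ for $X,Y\in V$. $\nabla$ is the Riemannian connection. $\alpha$-Sasakian: $(\nabla_XF)Y=\alpha\{\langle X,Y\rangle\xi-\eta(Y)X\}$; $\alpha$-Kenmotsu: $(\nabla_XF)Y=\alpha\{\langle FX,Y\rangle\xi-\eta(Y)FX\}$, for all vector fields $X,Y$, $\alpha$ a differentiable function. Let $\pi_1,\pi_2$ be the orthogonal projections onto $[\xi]$ and $V$. The canonical connection of the $U(n)\times1$-structure $P(U(n)\times 1)$ defined by $(F,\xi,\eta,g)$ is $$\overline\nabla_XY=\pi_1\nabla_X\pi_1Y+\tfrac12\pi_2(\nabla_X\pi_2Y-F\nabla_XF\pi_2Y),$$ and $h=\nabla-\overline\nabla$ is its second fundamental tensor field. The structure is called quasi homogeneous if $\overline\nabla h=0$ on $M$. *)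

(* Defs.v *)
From HB Require Import structures.
From mathcomp Require Import all_boot all_order all_algebra.
From mathcomp Require Import all_classical all_reals all_analysis.
From mathcomp Require Import ring.

Set Implicit Arguments.
Unset Strict Implicit.
Unset Printing Implicit Defensive.

Import Order.TTheory GRing.Theory Num.Theory.
Import numFieldNormedType.Exports.

Local Open Scope classical_set_scope.
Local Open Scope ring_scope.

Section smooth_on.
Context {R : realType} {m : nat}.
Implicit Types (U : set 'rV[R]_m) (f g : 'rV[R]_m -> R).

(* f is of class C^k on U; only meaningful for U open. *)
Fixpoint class_C (k : nat) U f : Prop :=
  (forall x, U x -> {for x, continuous f}) /\
  (if k is k'.+1 then
     forall i : 'I_m,
       (forall x, U x -> derivable f x (delta_mx 0 i)) /\
       class_C k' U (fun x => 'D_(delta_mx 0 i) f x)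
   else True).

Definition smooth_on U f := forall k, class_C k U f.

Lemma class_C_le k U f : class_C k.+1 U f -> class_C k U f.
Proof.
elim: k f => [|k IH] f [cf df]; first by split.
by split=> // i; have [d1 /IH d2] := df i; split.
Qed.

Lemma class_C_eq k U f g : open U ->
  (forall x, U x -> f x = g x) -> class_C k U f -> class_C k U g.
Proof.
move=> oU; have near_eq (f1 f2 : 'rV[R]_m -> R) x :
    (forall y, U y -> f1 y = f2 y) -> U x -> {near x, f1 =1 f2}.
  move=> f12 Ux; apply: filterS (open_nbhs_nbhs (conj oU Ux)).
  by move=> y; exact: f12.
have cont (f1 f2 : 'rV[R]_m -> R) : (forall y, U y -> f1 y = f2 y) ->
    (forall x, U x -> {for x, continuous f1}) ->
    forall x, U x -> {for x, continuous f2}.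
  move=> f12 cf1 x Ux; rewrite /prop_for /continuous_at -(f12 x Ux).
  exact: cvg_trans (near_eq_cvg (near_eq _ _ _ f12 Ux)) (cf1 x Ux).
elim: k f g => [|k IH] f g fg [cf df]; first by split=> //; exact: cont cf.
split=> [|i]; first exact: cont cf.
have [d1 d2] := df i; split=> [x Ux|].
  exact: near_eq_derivable (near_eq _ _ _ fg Ux) (d1 x Ux).
by apply: IH d2 => x Ux; apply: near_eq_derive; exact: near_eq fg Ux.
Qed.

Lemma class_C_cst k U (c : R) : open U -> class_C k U (cst c).
Proof.
move=> oU; elim: k c => [|k IH] c; first by split=> // x _; exact: cst_continuous.
split=> [x _|i]; first exact: cst_continuous.
split=> [x _|]; first exact: derivable_cst.
by apply: class_C_eq (IH 0) => // x _; rewrite derive_cst.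
Qed.

Lemma class_C_D k U f g : open U ->
  class_C k U f -> class_C k U g -> class_C k U (f \+ g).
Proof.
move=> oU; elim: k f g => [|k IH] f g [cf df] [cg dg].
  by split=> // x Ux; apply: continuousD; [exact: cf|exact: cg].
split=> [x Ux|i]; first by apply: continuousD; [exact: cf|exact: cg].
have [f1 f2] := df i; have [g1 g2] := dg i; split=> [x Ux|].
  by apply: derivableD; [exact: f1|exact: g1].
apply: class_C_eq (IH _ _ f2 g2) => // x Ux /=.
by rewrite -deriveD//; [exact: f1|exact: g1].
Qed.

Lemma class_C_M k U f g : open U ->
  class_C k U f -> class_C k U g -> class_C k U (f \* g).
Proof.
move=> oU; elim: k f g => [|k IH] f g fC gC.
  case: fC gC => [cf _] [cg _].
  by split=> // x Ux; apply: continuousM; [exact: cf|exact: cg].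
have [cf df] := fC; have [cg dg] := gC.
split=> [x Ux|i]; first by apply: continuousM; [exact: cf|exact: cg].
have [f1 f2] := df i; have [g1 g2] := dg i; split=> [x Ux|].
  by apply: derivableM; [exact: f1|exact: g1].
apply: (@class_C_eq _ _ ((f \* (fun x => 'D_(delta_mx 0 i) g x)) \+
                         (g \* (fun x => 'D_(delta_mx 0 i) f x)))) => //.
  by move=> x Ux; rewrite [RHS](deriveM (f1 x Ux) (g1 x Ux)).
by apply: class_C_D => //; apply: IH => //; exact: class_C_le.
Qed.

End smooth_on.

Record chart (R : realType) (m : nat) (M : topologicalType) := Chart {
  chart_dom : set M ;
  chart_map : M -> 'rV[R]_m ;
  chart_inv : 'rV[R]_m -> M ;
  chart_dom_open : open chart_dom ;
  chart_codom_open : open (chart_map @` chart_dom) ;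
  chart_mapK : forall p, chart_dom p -> chart_inv (chart_map p) = p ;
  chart_map_continuous :
    forall p, chart_dom p -> {for p, continuous chart_map} ;
  chart_inv_continuous :
    forall x, (chart_map @` chart_dom) x -> {for x, continuous chart_inv} }.

(* The atlas need not be maximal: smoothness only depends on the maximal atlas
   that it generates. *)
Record manifold (R : realType) (m : nat) := Manifold {
  manifold_space :> topologicalType ;
  atlas : set (chart R m manifold_space) ;
  atlas_cover : forall p, exists2 c, atlas c & chart_dom c p ;
  atlas_compatible : forall c d, atlas c -> atlas d -> forall i : 'I_m,
    smooth_on (chart_map c @` (chart_dom c `&` chart_dom d))
      (fun x => chart_map d (chart_inv c x) 0 i) ;
  manifold_hausdorff : hausdorff_space manifold_space ;
  manifold_second_countable : @second_countable manifold_space }.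

Definition is_smooth (R : realType) (m : nat) (M : manifold R m)
    (f : M -> R) : Prop :=
  forall c, atlas c ->
    smooth_on (chart_map c @` chart_dom c) (f \o chart_inv c).

Section smoothfun.
Context {R : realType} {m : nat} {M : manifold R m}.
Implicit Types f g : M -> R.

Lemma is_smooth_cst (a : R) : is_smooth (cst a : M -> R).
Proof. by move=> c _ k; apply: class_C_cst; exact: chart_codom_open. Qed.

Lemma is_smoothD f g : is_smooth f -> is_smooth g -> is_smooth (f + g).
Proof.
move=> fS gS c ac k; apply: class_C_D; first exact: chart_codom_open.
  exact: fS.
exact: gS.
Qed.

Lemma is_smoothM f g : is_smooth f -> is_smooth g -> is_smooth (f * g).
Proof.
move=> fS gS c ac k; apply: class_C_M; first exact: chart_codom_open.
  exact: fS.
exact: gS.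
Qed.

Lemma is_smoothZ (a : R) f : is_smooth f -> is_smooth (a *: f).
Proof. by move=> fS; exact: is_smoothM (is_smooth_cst a) fS. Qed.

Lemma is_smoothN f : is_smooth f -> is_smooth (- f).
Proof. by move=> fS; rewrite -scaleN1r; exact: is_smoothZ. Qed.

Definition smooth_pred : {pred M -> R} := mem [set f | is_smooth f].

Lemma smooth_predP f : reflect (is_smooth f) (f \in smooth_pred).
Proof. by apply: (iffP idP); rewrite inE. Qed.

Lemma smooth_subring_closed : subring_closed smooth_pred.
Proof.
split=> [|f g /smooth_predP fS /smooth_predP gS|
          f g /smooth_predP fS /smooth_predP gS]; apply/smooth_predP.
- exact: is_smooth_cst.
- by apply: is_smoothD => //; exact: is_smoothN.
- exact: is_smoothM.
Qed.

Lemma smooth_submod_closed : submod_closed smooth_pred.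
Proof.
split=> [|a f g /smooth_predP fS /smooth_predP gS]; apply/smooth_predP.
  exact: (is_smooth_cst 0).
by apply: is_smoothD => //; exact: is_smoothZ.
Qed.

End smoothfun.

Record smoothfun (R : realType) (m : nat) (M : manifold R m) := SmoothFun {
  smoothfun_val :> M -> R ;
  smoothfunP : smoothfun_val \in smooth_pred }.

Section smoothfun_algebra.
Context {R : realType} {m : nat} {M : manifold R m}.

HB.instance Definition _ := [isSub for @smoothfun_val R m M].
HB.instance Definition _ := [Choice of smoothfun M by <:].
HB.instance Definition _ :=
  GRing.SubChoice_isSubComPzRing.Build (M -> R) _ (smoothfun M)
    smooth_subring_closed.
HB.instance Definition _ :=
  GRing.SubZmodule_isSubLmodule.Build R (M -> R) _ (smoothfun M)
    smooth_submod_closed.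

Definition mk_smooth (f : M -> R) (fS : is_smooth f) : smoothfun M :=
  SmoothFun (introT (smooth_predP f) fS).

Definition smooth_cst (a : R) : smoothfun M := mk_smooth (is_smooth_cst a).

Lemma smoothfun_smooth (f : smoothfun M) : is_smooth f.
Proof. by apply/smooth_predP; exact: smoothfunP. Qed.

Lemma smoothfun_eqP (f g : smoothfun M) : (f =1 g) <-> f = g.
Proof. by split=> [fg|->//]; apply: val_inj; apply/funext. Qed.

End smoothfun_algebra.

Section tangent.
Context {R : realType} {m : nat} {M : manifold R m} (p : M).

(* Tangent vectors at p are the derivations at p of the algebra of smooth
   functions. *)
Definition is_tangent (v : smoothfun M -> R) : Prop :=
  scalar v /\ forall f g, v (f * g) = f p * v g + g p * v f.

Definition tangent_pred : {pred smoothfun M -> R} := mem [set v | is_tangent v].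

Lemma tangent_predP v : reflect (is_tangent v) (v \in tangent_pred).
Proof. by apply: (iffP idP); rewrite inE. Qed.

Lemma tangent_submod_closed : submod_closed tangent_pred.
Proof.
split=> [|a u v /tangent_predP[ul uM] /tangent_predP[vl vM]]; apply/tangent_predP.
  by split=> [a f g|f g]; rewrite /GRing.zero/= ?mulr0 addr0.
have E f : (a *: u + v) f = a * u f + v f by [].
by split=> [b f g|f g]; rewrite !E ?ul ?uM ?vl ?vM /=; ring.
Qed.

End tangent.

Record tangent (R : realType) (m : nat) (M : manifold R m) (p : M) := Tangent {
  tangent_val :> smoothfun M -> R ;
  tangentP : tangent_val \in tangent_pred p }.

Section tangent_space.
Context {R : realType} {m : nat} {M : manifold R m} (p : M).

HB.instance Definition _ := [isSub for @tangent_val R m M p].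
HB.instance Definition _ := [Choice of tangent p by <:].
HB.instance Definition _ :=
  GRing.SubChoice_isSubLmodule.Build R (smoothfun M -> R) _ (tangent p)
    (tangent_submod_closed p).

Definition mk_tangent v (vT : is_tangent p v) : tangent p :=
  Tangent (introT (tangent_predP p v) vT).

Lemma tangent_is_tangent (v : tangent p) : is_tangent p v.
Proof. by apply/tangent_predP; exact: tangentP. Qed.

Lemma tangent_eqP (u v : tangent p) : (u =1 v) <-> u = v.
Proof. by split=> [uv|->//]; apply: val_inj; apply/funext. Qed.

End tangent_space.

Record vfield (R : realType) (m : nat) (M : manifold R m) := VField {
  vfield_at :> forall p : M, tangent p ;
  vfield_smooth : forall f : smoothfun M, is_smooth (fun p => vfield_at p f) }.

Section vfield.
Context {R : realType} {m : nat} {M : manifold R m}.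
Implicit Types (X Y Z : vfield M) (f g : smoothfun M).

Lemma vfield_eqP X Y : (forall p, X p = Y p) <-> X = Y.
Proof.
split=> [|->//]; case: X Y => [X Xs] [Y Ys] /= XY.
have {}XY : X = Y by apply: functional_extensionality_dep.
by case: Y / XY Ys => Ys; congr VField; exact: Prop_irrelevance.
Qed.

Lemma vfield_zero_subproof f : is_smooth (fun p : M => (0 : tangent p) f).
Proof. exact: (is_smooth_cst 0). Qed.

Lemma vfield_add_subproof X Y f : is_smooth (fun p => (X p + Y p) f).
Proof. by apply: is_smoothD; exact: vfield_smooth. Qed.

Lemma vfield_opp_subproof X f : is_smooth (fun p => (- X p) f).
Proof. by apply: is_smoothN; exact: vfield_smooth. Qed.

Lemma vfield_scale_subproof f X g : is_smooth (fun p => (f p *: X p) g).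
Proof.
by apply: is_smoothM; [exact: smoothfun_smooth|exact: vfield_smooth].
Qed.

Definition vfield_zero := VField vfield_zero_subproof.
Definition vfield_add X Y := VField (vfield_add_subproof X Y).
Definition vfield_opp X := VField (vfield_opp_subproof X).
Definition vfield_scale f X := VField (vfield_scale_subproof f X).

HB.instance Definition _ := gen_eqMixin (vfield M).
HB.instance Definition _ := gen_choiceMixin (vfield M).

Let addA : associative vfield_add.
Proof. by move=> X Y Z; apply/vfield_eqP => p; rewrite /= addrA. Qed.
Let addC : commutative vfield_add.
Proof. by move=> X Y; apply/vfield_eqP => p; rewrite /= addrC. Qed.
Let add0 : left_id vfield_zero vfield_add.
Proof. by move=> X; apply/vfield_eqP => p; rewrite /= add0r. Qed.
Let addN : left_inverse vfield_zero vfield_opp vfield_add.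
Proof. by move=> X; apply/vfield_eqP => p; rewrite /= addNr. Qed.

HB.instance Definition _ :=
  GRing.isZmodule.Build (vfield M) addA addC add0 addN.

Let scaleA f g X : vfield_scale f (vfield_scale g X) = vfield_scale (f * g) X.
Proof. by apply/vfield_eqP => p; rewrite /= scalerA. Qed.
Let scale1 : left_id 1 vfield_scale.
Proof. by move=> X; apply/vfield_eqP => p; rewrite /= scale1r. Qed.
Let scaleDr : right_distributive vfield_scale +%R.
Proof. by move=> f X Y; apply/vfield_eqP => p; rewrite /= scalerDr. Qed.
Let scaleDl X : {morph vfield_scale^~ X : f g / f + g}.
Proof. by move=> f g; apply/vfield_eqP => p; rewrite /= scalerDl. Qed.

HB.instance Definition _ := GRing.Zmodule_isLmodule.Build
  (smoothfun M) (vfield M) scaleA scale1 scaleDr scaleDl.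

Definition vfield_app X f : smoothfun M := mk_smooth (vfield_smooth X f).

Definition bracket_at X Y (p : M) f : R :=
  X p (vfield_app Y f) - Y p (vfield_app X f).

Lemma vfield_app_linear X (a : R) f g :
  vfield_app X (a *: f + g) = a *: vfield_app X f + vfield_app X g.
Proof. by apply/smoothfun_eqP => p /=; rewrite (tangent_is_tangent (X p)).1. Qed.

Lemma vfield_appM X f g :
  vfield_app X (f * g) = f * vfield_app X g + g * vfield_app X f.
Proof. by apply/smoothfun_eqP => p /=; rewrite (tangent_is_tangent (X p)).2. Qed.

Lemma tangentD (p : M) (v : tangent p) f g : v (f + g) = v f + v g.
Proof. by have := (tangent_is_tangent v).1 1 f g; rewrite scale1r mul1r. Qed.

Lemma bracket_is_tangent X Y p : is_tangent p (bracket_at X Y p).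
Proof.
split=> [a f g|f g]; rewrite /bracket_at.
  rewrite !vfield_app_linear.
  rewrite (tangent_is_tangent (X p)).1 (tangent_is_tangent (Y p)).1.
  by rewrite mulrBr opprD addrACA.
rewrite !vfield_appM !tangentD.
rewrite !(tangent_is_tangent (X p)).2 !(tangent_is_tangent (Y p)).2 /=.
ring.
Qed.

Lemma bracket_smooth X Y f :
  is_smooth (fun p => mk_tangent (bracket_is_tangent X Y p) f).
Proof.
apply: is_smoothD; first exact: vfield_smooth.
by apply: is_smoothN; exact: vfield_smooth.
Qed.

Definition bracket X Y : vfield M := VField (bracket_smooth X Y).

End vfield.

Record riemannian_metric (R : realType) (m : nat) (M : manifold R m) :=
  RiemannianMetric {
    metric_at :> forall p : M, tangent p -> tangent p -> R ;
    metric_linear : forall p (w : tangent p), scalar (fun v => metric_at v w) ;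
    metric_sym : forall p (v w : tangent p), metric_at v w = metric_at w v ;
    metric_pos : forall p (v : tangent p), v != 0 -> 0 < metric_at v v ;
    metric_smooth : forall X Y : vfield M,
      is_smooth (fun p => metric_at (X p) (Y p)) }.

(* A field of endomorphisms of the tangent spaces, smooth in the sense that it
   sends smooth vector fields to smooth vector fields. *)
Record tensor11 (R : realType) (m : nat) (M : manifold R m) := Tensor11 {
  tensor11_at :> forall p : M, {linear tangent p -> tangent p} ;
  tensor11_smooth : forall (X : vfield M) (f : smoothfun M),
    is_smooth (fun p => tensor11_at p (X p) f) }.

Section riemannian.
Context {R : realType} {m : nat} {M : manifold R m}.

Definition metric_vf (g : riemannian_metric M) (X Y : vfield M) : smoothfun M :=
  mk_smooth (metric_smooth g X Y).

Definition tensor11_vf (F : tensor11 M) (X : vfield M) : vfield M :=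
  VField (tensor11_smooth F X).

Definition is_connection (D : vfield M -> vfield M -> vfield M) : Prop :=
  [/\ forall (f : smoothfun M) X Y Z, D (f *: X + Y) Z = f *: D X Z + D Y Z,
      forall X Y Z, D X (Y + Z) = D X Y + D X Z &
      forall X (f : smoothfun M) Y, D X (f *: Y) = vfield_app X f *: Y + f *: D X Y].

Definition is_levi_civita (g : riemannian_metric M)
    (D : vfield M -> vfield M -> vfield M) : Prop :=
  [/\ is_connection D,
      forall X Y Z, vfield_app X (metric_vf g Y Z) =
        metric_vf g (D X Y) Z + metric_vf g Y (D X Z) &
      forall X Y, D X Y - D Y X = bracket X Y].

Definition covariant_tensor11 (D : vfield M -> vfield M -> vfield M)
    (F : tensor11 M) (X Y : vfield M) : vfield M :=
  D X (tensor11_vf F Y) - tensor11_vf F (D X Y).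

(* (D_X h)(Y, Z), for h a tensor field of type (1,2). *)
Definition covariant_tensor12 (D h : vfield M -> vfield M -> vfield M)
    (X Y Z : vfield M) : vfield M :=
  D X (h Y Z) - h (D X Y) Z - h Y (D X Z).

End riemannian.

Record almost_contact_metric (R : realType) (m : nat) (M : manifold R m) :=
  AlmostContactMetric {
    acm_metric : riemannian_metric M ;
    acm_xi : vfield M ;
    acm_F : tensor11 M ;
    acm_xi_unit : forall p, acm_metric p (acm_xi p) (acm_xi p) = 1 ;
    acm_F_xi : forall p, acm_F p (acm_xi p) = 0 ;
    acm_F_stable : forall p (v : tangent p),
      acm_metric p v (acm_xi p) = 0 -> acm_metric p (acm_F p v) (acm_xi p) = 0 ;
    acm_F_square : forall p (v : tangent p),
      acm_metric p v (acm_xi p) = 0 -> acm_F p (acm_F p v) = - v ;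
    acm_F_isometry : forall p (v w : tangent p),
      acm_metric p v (acm_xi p) = 0 -> acm_metric p w (acm_xi p) = 0 ->
      acm_metric p (acm_F p v) (acm_F p w) = acm_metric p v w }.

Section almost_contact.
Context {R : realType} {m : nat} {M : manifold R m}.
Variable S : almost_contact_metric M.
Variable nabla : vfield M -> vfield M -> vfield M.
Implicit Types X Y Z : vfield M.

Local Notation xi := (acm_xi S).
Local Notation F := (tensor11_vf (acm_F S)).
Local Notation g := (metric_vf (acm_metric S)).

Definition acm_eta X : smoothfun M := g X xi.

Local Notation eta := acm_eta.

Definition alpha_sasakian (alpha : smoothfun M) : Prop :=
  forall X Y, covariant_tensor11 nabla (acm_F S) X Y =
    alpha *: (g X Y *: xi - eta Y *: X).

Definition alpha_kenmotsu (alpha : smoothfun M) : Prop :=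
  forall X Y, covariant_tensor11 nabla (acm_F S) X Y =
    alpha *: (g (F X) Y *: xi - eta Y *: F X).

(* Since xi is a unit field, these are the orthogonal projections onto the line
   spanned by xi and onto its orthogonal complement V. *)
Definition pi1 X : vfield M := eta X *: xi.
Definition pi2 X : vfield M := X - pi1 X.

(* The canonical connection of the U(n) x 1-structure defined by S, for nabla
   the Levi-Civita connection. *)
Definition canonical_connection X Y : vfield M :=
  pi1 (nabla X (pi1 Y)) +
  smooth_cst 2^-1 *: pi2 (nabla X (pi2 Y) - F (nabla X (F (pi2 Y)))).

Definition second_fundamental X Y : vfield M :=
  nabla X Y - canonical_connection X Y.

Definition quasi_homogeneous : Prop :=
  forall X Y Z,
    covariant_tensor12 canonical_connection second_fundamental X Y Z = 0.

End almost_contact.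

(* Main.v *)
Require Import Defs.
From mathcomp Require Import all_boot all_order all_algebra.
From mathcomp Require Import all_classical all_reals all_analysis.
From mathcomp Require Import ring lra.

(** Everything is governed by the single operator [A X = nabla_X xi]. In both
    classes the derivative of [F] is determined by [A] through the same formula
    [(nabla_X F) Y = <F A X, Y> xi - eta(Y) F A X] ([nabla_F_shape]): putting
    [Y = xi] in the defining identity gives [A = - alpha F] in the Sasakian case
    and [A = - alpha F^2] in the Kenmotsu case, and the defining identity is the
    displayed formula for that [A].

    The formula makes the canonical connection explicit
    ([canonical_connectionE]):
    [nablabar_X Y = nabla_X Y + <A X, Y> xi - eta(Y) A X], that is,
    [h_X Y = eta(Y) A X - <A X, Y> xi].
    The operator [h_X] is skew and [h_X xi = A X], so [nablabar] is metric and
    [nablabar xi = 0]; and the formula for [nabla F] says exactly that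
    [nablabar F = 0].  As [h] is built from [g], [xi], [eta] and [A] alone,
    [nablabar h = 0] follows from [nablabar A = 0]
    ([parallel_derivative_quasi_homogeneous]); and [A] is a constant multiple of
    [F] or of [F^2], hence parallel. *)

Set Implicit Arguments.
Unset Strict Implicit.
Unset Printing Implicit Defensive.

Import GRing.Theory Num.Theory.

Local Open Scope ring_scope.

(** * Module identities between vector fields *)

Section evaluation.
Context {R : realType} {m : nat} {M : manifold R m}.
Implicit Types (X Y : vfield M) (f g u : smoothfun M) (p : M).

Lemma smooth0E p : (0 : smoothfun M) p = 0. Proof. by []. Qed.
Lemma smooth1E p : (1 : smoothfun M) p = 1. Proof. by []. Qed.
Lemma smoothDE f g p : (f + g) p = f p + g p. Proof. by []. Qed.
Lemma smoothNE f p : (- f) p = - f p. Proof. by []. Qed.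
Lemma smoothME f g p : (f * g) p = f p * g p. Proof. by []. Qed.
Lemma smooth_cstE (a : R) p : (smooth_cst a : smoothfun M) p = a.
Proof. by []. Qed.
Lemma vfield0E p u : (0 : vfield M) p u = 0. Proof. by []. Qed.
Lemma vfieldDE X Y p u : (X + Y) p u = X p u + Y p u. Proof. by []. Qed.
Lemma vfieldNE X p u : (- X) p u = - X p u. Proof. by []. Qed.
Lemma vfieldZE f X p u : (f *: X) p u = f p * X p u. Proof. by []. Qed.

Definition evalE := (smooth0E, smooth1E, smoothDE, smoothNE, smoothME,
  smooth_cstE, vfield0E, vfieldDE, vfieldNE, vfieldZE).

End evaluation.

(** A vector field is determined by its values on smooth functions at points,
    where a module identity over the smooth functions becomes a ring identity
    over the reals. *)
Ltac module_ring :=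
  apply/vfield_eqP => ?; apply/tangent_eqP => ?; rewrite !evalE; ring.

Section vector_fields.
Context {R : realType} {m : nat} {M : manifold R m}.
Implicit Types (X Y Z : vfield M) (f : smoothfun M).

Lemma half_double X : smooth_cst 2^-1 *: (X + X) = X.
Proof.
by apply/vfield_eqP => p; apply/tangent_eqP => u; rewrite !evalE; field.
Qed.

Lemma smooth_double_eq0 f : f + f = 0 -> f = 0.
Proof.
move=> /smoothfun_eqP ff0; apply/smoothfun_eqP => p.
by have := ff0 p; rewrite !evalE; lra.
Qed.

Lemma vfield_app_cst X f : (exists c : R, forall p, f p = c) ->
  vfield_app X f = 0.
Proof.
move=> [c fc].
have X0 : vfield_app X 0 = 0.
  by have := vfield_appM X 0 0; rewrite !mul0r addr0.
have X1 : vfield_app X 1 = 0.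
  have := vfield_appM X 1 1; rewrite !mul1r => X1.
  by apply: (addrI (vfield_app X 1)); rewrite -X1 addr0.
have -> : f = c *: (1 : smoothfun M) + 0.
  by apply/smoothfun_eqP => p; rewrite fc addr0; exact/esym/mulr1.
by rewrite vfield_app_linear X0 X1 scaler0 addr0.
Qed.

Lemma vfield_appN X f : vfield_app X (- f) = - vfield_app X f.
Proof.
rewrite -mulN1r vfield_appM (@vfield_app_cst X (- 1)); last by exists (- 1).
by rewrite mulr0 addr0 mulN1r.
Qed.

Section metric.
Variable g : riemannian_metric M.

Lemma metricC X Y : metric_vf g X Y = metric_vf g Y X.
Proof. by apply/smoothfun_eqP => p; exact: Defs.metric_sym. Qed.

Lemma metricPl f X Y Z :
  metric_vf g (f *: X + Y) Z = f * metric_vf g X Z + metric_vf g Y Z.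
Proof. by apply/smoothfun_eqP => p; exact: metric_linear. Qed.

Lemma metricDl X Y Z : metric_vf g (X + Y) Z = metric_vf g X Z + metric_vf g Y Z.
Proof. by rewrite -{1}(scale1r X) metricPl mul1r. Qed.

Lemma metric0l Z : metric_vf g 0 Z = 0.
Proof. by apply: (addrI (metric_vf g 0 Z)); rewrite -metricDl !addr0. Qed.

Lemma metricZl f X Z : metric_vf g (f *: X) Z = f * metric_vf g X Z.
Proof. by rewrite -{1}(addr0 (f *: X)) metricPl metric0l addr0. Qed.

Lemma metricNl X Z : metric_vf g (- X) Z = - metric_vf g X Z.
Proof. by rewrite -scaleN1r metricZl mulN1r. Qed.

Lemma metricDr X Y Z : metric_vf g Z (X + Y) = metric_vf g Z X + metric_vf g Z Y.
Proof. by rewrite metricC metricDl !(metricC Z). Qed.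

Lemma metricZr f X Z : metric_vf g Z (f *: X) = f * metric_vf g Z X.
Proof. by rewrite metricC metricZl (metricC Z). Qed.

Lemma metricNr X Z : metric_vf g Z (- X) = - metric_vf g Z X.
Proof. by rewrite metricC metricNl (metricC Z). Qed.

Definition metricE := (metricDl, metricZl, metricNl, metricDr, metricZr, metricNr).

End metric.

Section endomorphism.
Variable F : tensor11 M.

Lemma tensor11D X Y : tensor11_vf F (X + Y) = tensor11_vf F X + tensor11_vf F Y.
Proof. by apply/vfield_eqP => p; rewrite /= linearD. Qed.

Lemma tensor11N X : tensor11_vf F (- X) = - tensor11_vf F X.
Proof. by apply/vfield_eqP => p; rewrite /= linearN. Qed.

Lemma tensor11Z f X : tensor11_vf F (f *: X) = f *: tensor11_vf F X.
Proof. by apply/vfield_eqP => p; rewrite /= linearZ. Qed.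

Definition tensor11E := (tensor11D, tensor11N, tensor11Z).

End endomorphism.

Section connection.
Variable D : vfield M -> vfield M -> vfield M.
Hypothesis HD : is_connection D.

Lemma connectionD X Y Z : D X (Y + Z) = D X Y + D X Z.
Proof. by case: HD. Qed.

Lemma connectionM X f Y : D X (f *: Y) = vfield_app X f *: Y + f *: D X Y.
Proof. by case: HD. Qed.

Lemma connectionN X Y : D X (- Y) = - D X Y.
Proof.
rewrite -scaleN1r connectionM vfield_app_cst ?scale0r ?add0r ?scaleN1r//.
by exists (- 1).
Qed.

End connection.

End vector_fields.

(** * Algebra of an almost contact metric structure *)

Section almost_contact.
Context {R : realType} {m : nat} {M : manifold R m}.
Variable S : almost_contact_metric M.
Implicit Types X Y Z : vfield M.

Local Notation xi := (acm_xi S).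
Local Notation F := (tensor11_vf (acm_F S)).
Local Notation g := (metric_vf (acm_metric S)).
Local Notation eta := (acm_eta S).

Lemma eta_xi : eta xi = 1.
Proof. by apply/smoothfun_eqP => p; exact: acm_xi_unit. Qed.

Lemma F_xi : F xi = 0.
Proof. by apply/vfield_eqP => p; exact: acm_F_xi. Qed.

Lemma eta_pi2 X : eta (pi2 S X) = 0.
Proof. by rewrite /acm_eta !metricE -/(eta xi) eta_xi mulr1 subrr. Qed.

Lemma F_pi2 X : F (pi2 S X) = F X.
Proof. by rewrite /pi2 !tensor11E F_xi scaler0 subr0. Qed.

Lemma eta_pi2_at X p : acm_metric S p (pi2 S X p) (xi p) = 0.
Proof. by have /smoothfun_eqP := eta_pi2 X; exact. Qed.

Lemma eta_F X : eta (F X) = 0.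
Proof.
rewrite -F_pi2; apply/smoothfun_eqP => p.
by apply: acm_F_stable; exact: eta_pi2_at.
Qed.

Lemma F_square X : F (F X) = eta X *: xi - X.
Proof.
have -> : eta X *: xi - X = - pi2 S X by rewrite opprB.
rewrite -(F_pi2 X); apply/vfield_eqP => p.
by apply: acm_F_square; exact: eta_pi2_at.
Qed.

Lemma metric_pi2l X Y : eta Y = 0 -> g (pi2 S X) Y = g X Y.
Proof. by move=> Y0; rewrite !metricE (metricC _ xi) -/(eta Y) Y0 mulr0 subr0. Qed.

Lemma F_isometry X Y : g (F X) (F Y) = g (pi2 S X) (pi2 S Y).
Proof.
rewrite -(F_pi2 X) -(F_pi2 Y); apply/smoothfun_eqP => p.
by apply: acm_F_isometry; exact: eta_pi2_at.
Qed.

(** Apply the isometry property of [F] to [X] and [F Y], and use that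
    [F^2 = -1] on [V]. *)
Lemma F_skew X Y : g (F X) Y = - g X (F Y).
Proof.
have F_isometry_F : g (F X) (F (F Y)) = g X (F Y).
  by rewrite F_isometry {2}/pi2 /pi1 eta_F scale0r subr0 metric_pi2l ?eta_F.
rewrite -F_isometry_F F_square !metricE -/(eta (F X)) eta_F.
by rewrite mulr0 sub0r opprK.
Qed.

(** * The canonical connection *)

Variable nabla : vfield M -> vfield M -> vfield M.
Hypothesis Hnabla : is_levi_civita (acm_metric S) nabla.

Local Notation A X := (nabla X xi).
Local Notation nablabar := (canonical_connection S nabla).

Let nablaC : is_connection nabla. Proof. by case: Hnabla. Qed.

Let nabla_metric X Y Z :
  vfield_app X (g Y Z) = g (nabla X Y) Z + g Y (nabla X Z).
Proof. by case: Hnabla. Qed.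

Let nablaE := (connectionD nablaC, connectionN nablaC, connectionM nablaC).

(** Because [2 <A X, xi> = X <xi, xi> = X 1 = 0]. *)
Lemma eta_nabla_xi X : eta (A X) = 0.
Proof.
apply: smooth_double_eq0; rewrite /acm_eta {2}metricC -nabla_metric.
by apply: vfield_app_cst; exists 1 => p; exact: acm_xi_unit.
Qed.

Lemma vfield_app_eta X Y : vfield_app X (eta Y) = eta (nabla X Y) + g (A X) Y.
Proof. by rewrite nabla_metric (metricC _ Y). Qed.

(** What the Sasakian and the Kenmotsu identities have in common: in
    [V] the structure tensor [F] is parallel up to [xi], so that its derivative
    only depends on that of [xi]. *)
Definition nabla_F_shape := forall X Y,
  covariant_tensor11 nabla (acm_F S) X Y =
    g (F (A X)) Y *: xi - eta Y *: F (A X).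

Lemma F_square_nabla_xi X : F (F (A X)) = - A X.
Proof. by rewrite F_square eta_nabla_xi scale0r add0r. Qed.

Section shape.
Hypothesis nablaF : nabla_F_shape.

Lemma nabla_F X Y :
  nabla X (F Y) = F (nabla X Y) + g (F (A X)) Y *: xi - eta Y *: F (A X).
Proof. by rewrite -addrA -nablaF addrC subrK. Qed.

(** By [nabla_F], the field [- F nabla_X F Y] differs from the [V]-part of
    [nabla_X Y] only by a multiple of [A X], and so does [nabla_X (pi2 Y)] after
    projection to [V]: both are equal to [W], and so is their average. *)
Lemma canonical_connectionE X Y :
  nablabar X Y = nabla X Y + g (A X) Y *: xi - eta Y *: A X.
Proof.
pose W := pi2 S (nabla X Y) - eta Y *: A X.
have along : pi1 S (nabla X (pi1 S Y)) = vfield_app X (eta Y) *: xi.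
  rewrite /pi1 nablaE /acm_eta !metricE -!/(eta _) eta_xi eta_nabla_xi.
  by rewrite mulr1 mulr0 addr0.
have inner : nabla X (pi2 S Y) - F (nabla X (F (pi2 S Y))) =
    W + W + (eta (nabla X Y) - vfield_app X (eta Y)) *: xi.
  rewrite F_pi2 nabla_F !tensor11E F_xi F_square F_square_nabla_xi.
  rewrite /W /pi2 /pi1 !nablaE; module_ring.
have etaW : eta W = 0.
  rewrite /acm_eta metricDl metricNl metricZl -!/(eta _).
  by rewrite eta_pi2 eta_nabla_xi mulr0 subr0.
have across : pi2 S (nabla X (pi2 S Y) - F (nabla X (F (pi2 S Y)))) = W + W.
  rewrite inner /pi2 /pi1 /acm_eta metricDl metricZl metricDl -!/(eta _).
  by rewrite etaW eta_xi; module_ring.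
rewrite /canonical_connection along across half_double vfield_app_eta.
by rewrite /W /pi2 /pi1; module_ring.
Qed.

Lemma second_fundamentalE X Y :
  second_fundamental S nabla X Y = eta Y *: A X - g (A X) Y *: xi.
Proof. by rewrite /second_fundamental canonical_connectionE; module_ring. Qed.

Lemma canonicalD X Y Z : nablabar X (Y + Z) = nablabar X Y + nablabar X Z.
Proof.
rewrite !canonical_connectionE !nablaE /acm_eta !metricE; module_ring.
Qed.

Lemma canonicalM X f Y :
  nablabar X (f *: Y) = vfield_app X f *: Y + f *: nablabar X Y.
Proof.
rewrite !canonical_connectionE !nablaE /acm_eta !metricE; module_ring.
Qed.

Lemma canonical_xi X : nablabar X xi = 0.
Proof.
rewrite canonical_connectionE eta_xi -/(eta (A X)) eta_nabla_xi.
by module_ring.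
Qed.

Lemma canonical_metric X Y Z :
  vfield_app X (g Y Z) = g (nablabar X Y) Z + g Y (nablabar X Z).
Proof.
rewrite nabla_metric !canonical_connectionE !metricE.
by rewrite (metricC _ xi) -!/(eta _) (metricC _ Y (A X)); ring.
Qed.

(** [nablabar F = 0]: the terms that [h] contributes cancel those of [nabla F],
    because [F] is skew. *)
Lemma canonical_F X Y : nablabar X (F Y) = F (nablabar X Y).
Proof.
rewrite !canonical_connectionE nabla_F !tensor11E F_xi eta_F F_skew.
by module_ring.
Qed.

Lemma canonical_eta X Y : vfield_app X (eta Y) = eta (nablabar X Y).
Proof.
by rewrite canonical_metric canonical_xi (metricC _ Y) metric0l addr0.
Qed.

(** The tensor [h] is an expression in [g], [xi], [eta] and [A], and the first
    three are parallel for [nablabar]. *)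
Lemma parallel_derivative_quasi_homogeneous :
  (forall X Y, nablabar X (A Y) = A (nablabar X Y)) ->
  quasi_homogeneous S nabla.
Proof.
move=> parA X Y Z; rewrite /covariant_tensor12 !second_fundamentalE.
rewrite -!scaleNr canonicalD !canonicalM canonical_xi -canonical_eta.
by rewrite vfield_appN canonical_metric !parA; module_ring.
Qed.

End shape.

(** * The two classes of structures *)

(** As [F xi = 0], the value of [nabla_X F] at [xi] is [- F A X], and [F]
    recovers [A X] from it because [A X] lies in [V], where [F^2 = -1]. *)
Lemma nabla_xiE X : A X = F (covariant_tensor11 nabla (acm_F S) X xi).
Proof.
(* [nabla X 0 = 0] is additivity at [0 + 0]. *)
have nabla0 : nabla X 0 = 0.
  by apply: (addrI (nabla X 0)); rewrite -(connectionD nablaC) !addr0.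
by rewrite /covariant_tensor11 F_xi nabla0 sub0r tensor11N F_square_nabla_xi opprK.
Qed.

Variable alpha : smoothfun M.

Lemma sasakian_nabla_xi :
  alpha_sasakian S nabla alpha -> forall X, A X = - alpha *: F X.
Proof.
move=> sas X; rewrite nabla_xiE sas !tensor11E F_xi eta_xi; module_ring.
Qed.

Lemma kenmotsu_nabla_xi :
  alpha_kenmotsu S nabla alpha -> forall X, A X = - alpha *: F (F X).
Proof.
move=> ken X; rewrite nabla_xiE ken !tensor11E F_xi eta_xi; module_ring.
Qed.

Lemma sasakian_shape : alpha_sasakian S nabla alpha -> nabla_F_shape.
Proof.
move=> sas X Y; rewrite sas sasakian_nabla_xi // !tensor11E F_square.
rewrite !metricE (metricC _ xi) -/(eta Y); module_ring.
Qed.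

Lemma kenmotsu_shape : alpha_kenmotsu S nabla alpha -> nabla_F_shape.
Proof.
move=> ken X Y; rewrite ken kenmotsu_nabla_xi // !tensor11E F_square eta_F.
rewrite !metricE; module_ring.
Qed.

Hypothesis alpha_cst : exists c : R, forall p : M, alpha p = c.

Lemma canonical_alphaZ (X Y : vfield M) : nabla_F_shape ->
  nablabar X (- alpha *: Y) = - alpha *: nablabar X Y.
Proof.
move=> nablaF; rewrite canonicalM // vfield_app_cst ?scale0r ?add0r //.
by have [c alphac] := alpha_cst; exists (- c) => p; rewrite evalE alphac.
Qed.

Lemma sasakian_quasi_homogeneous :
  alpha_sasakian S nabla alpha -> quasi_homogeneous S nabla.
Proof.
move=> sas; have nablaF := sasakian_shape sas.
apply: parallel_derivative_quasi_homogeneous => // X Y.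
by rewrite !sasakian_nabla_xi // canonical_alphaZ // canonical_F.
Qed.

Lemma kenmotsu_quasi_homogeneous :
  alpha_kenmotsu S nabla alpha -> quasi_homogeneous S nabla.
Proof.
move=> ken; have nablaF := kenmotsu_shape ken.
apply: parallel_derivative_quasi_homogeneous => // X Y.
by rewrite !kenmotsu_nabla_xi // canonical_alphaZ // !canonical_F.
Qed.

End almost_contact.

Theorem proposition7p6 (R : realType) (n : nat) (M : manifold R (2 * n).+1%N)
    (S : almost_contact_metric M) (nabla : vfield M -> vfield M -> vfield M)
    (Hnabla : is_levi_civita (acm_metric S) nabla)
    (alpha : smoothfun M) (Halpha : exists c : R, forall p : M, alpha p = c) :
  alpha_sasakian S nabla alpha \/ alpha_kenmotsu S nabla alpha ->
  quasi_homogeneous S nabla.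
Proof.
move=> [sas|ken].
- exact: (sasakian_quasi_homogeneous Hnabla Halpha sas).
- exact: (kenmotsu_quasi_homogeneous Hnabla Halpha ken).
Qed.
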